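(* Let $X_k\sim\mathcal{N}(0,\sigma_k^2)$, $k=1,\dots,n$ ($n\ge 2$, $\sigma_k>0$), be independent, and let $M=\mathrm{Med}(X_1,\dots,X_n)$. Let $t>0$ be such that $$\frac{n^{1/2}t^{1/2}}{0.35\sum_{k=1}^n\sigma_k^{-1}}\le\frac12\min_{1\le k\le n}\sigma_k.$$ If $n$ is even, then with probability at least $1-2e^{-2t}$, $$|M|\le\frac{n^{1/2}t^{1/2}}{0.35\sum_{k=1}^n\sigma_k^{-1}}.$$ If $n$ is odd and $tn\ge 4$, then with probability at least $1-2e^{-t/2}$, $$|M|\le\frac{n^{1/2}t^{1/2}}{0.35\sum_{k=1}^n\sigma_k^{-1}}.$$
   Context: Order statistics are in decreasing order: $X^{(1)}\ge\cdots\ge X^{(n)}$, so $X^{(j)}$ is the $j$-th largest of $X_1,\dots,X_n$. For $p\in(0,1)$ with $pn\ge1$, the $100(1-p)$%-th percentile of $X_1,\dots,X_n$ is $X^{(\lfloor pn\rfloor)}$; the median is the case $p=\frac12$, that is, $\mathrm{Med}(X_1,\dots,X_n)=X^{(\lfloor n/2\rfloor)}$. *)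

(* Defs.v *)
From HB Require Import structures.
From mathcomp Require Import all_boot all_order all_algebra.
From mathcomp Require Import all_classical all_reals all_analysis.

Set Implicit Arguments.
Unset Strict Implicit.
Unset Printing Implicit Defensive.
Import Order.TTheory GRing.Theory Num.Theory.
Local Open Scope classical_set_scope.
Local Open Scope ring_scope.

(* Mutual independence: the product rule holds for every subfamily. *)
Definition independent_RVs (d d' : measure_display) (T : measurableType d)
    (T' : measurableType d') (R : realType) (P : probability T R)
    (I : finType) (X : I -> {RV P >-> T'}) : Prop :=
  forall (J : {set I}) (B : I -> set T'),
    (forall i, i \in J -> measurable (B i)) ->
    P (\bigcap_(i in [set i | i \in J]) (X i @^-1` B i)) =
    (\prod_(i in J) P (X i @^-1` B i))%E.

(* Equality is required on measurable sets only, since the library's set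
   functions are unconstrained on the other sets. *)
Definition has_law (d d' : measure_display) (T : measurableType d)
    (T' : measurableType d') (R : realType) (P : probability T R)
    (X : {RV P >-> T'}) (mu : set T' -> \bar R) : Prop :=
  forall A : set T', measurable A -> distribution P X A = mu A.

(* The j-th largest of x_0, ..., x_(n-1), with j counted from 1
   (meaningful for 1 <= j <= n). *)
Definition order_stat (R : realType) (n : nat) (x : 'I_n -> R) (j : nat) : R :=
  nth 0 (sort >=%R [seq x i | i <- enum 'I_n]) j.-1.

(* The 100(1-p)%-th percentile, meaningful for 0 < p < 1 and 1 <= p * n;
   Num.truncn is the floor on nonnegative reals. *)
Definition percentile (R : realType) (n : nat) (p : R) (x : 'I_n -> R) : R :=
  order_stat x (Num.truncn (p * n%:R)).

Definition median (R : realType) (n : nat) (x : 'I_n -> R) : R :=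
  percentile 2^-1 x.

Lemma medianE (R : realType) (n : nat) (x : 'I_n -> R) :
  median x = order_stat x n./2.
Proof.
rewrite /median /percentile; congr order_stat; apply: truncn_def.
rewrite mulrC ler_pdivlMr// ltr_pdivrMr// -!natrM ler_nat ltr_nat !muln2.
rewrite -[X in (_ <= X < _)%N]odd_double_half doubleS.
by case: (odd n); rewrite ?leqnn ?leqnSn ?leqW.
Qed.

(* n^(1/2) t^(1/2) / (0.35 * sum_k 1/sigma_k) *)
Definition median_bound (R : realType) (n : nat) (sigma : 'I_n -> R) (t : R) : R :=
  Num.sqrt n%:R * Num.sqrt t / (35%:R / 100%:R * \sum_(k < n) (sigma k)^-1).

(* Main.v *)
Require Import Defs.
From HB Require Import structures.
From mathcomp Require Import all_boot all_order all_algebra.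
From mathcomp Require Import all_classical all_reals all_analysis.
From mathcomp Require Import measurable_realfun zify ring lra.

Import Order.TTheory GRing.Theory Num.Theory.
Local Open Scope classical_set_scope.
Local Open Scope ring_scope.

(** Write [s] for the bound and [A = sqrt (n t)], so that
    [0.35 * \sum_k s / sigma_k = A]. The median exceeds [s] exactly when at
    least [n./2] of the [X_k] exceed [s], and it is below [- s] exactly when
    at least [n - n./2 + 1] of them are below [- s]. Each of these two events
    thus bounds from below a sum of [n] independent indicators.

    By symmetry, [X_k] exceeds [s] with probability
    [1/2 - P (`|X_k| <= s) / 2]. The hypothesis on [t] says that
    [s / sigma_k <= 1/2] for every [k], and on [[- 1/2, 1/2]] the standard
    normal density is at least [exp (- 1/8) / sqrt (2 pi) >= 0.35]; hence the
    success probabilities, in either tail, are at most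
    [1/2 - 0.35 * s / sigma_k] and sum to at most [n/2 - A]
    ([normal_tail_le]). The number of successes must therefore exceed its mean
    by [A] when [n] is even, and by [A - 1/2] in the worse of the two tails
    when [n] is odd; in the latter case [t n >= 4] gives [A >= 2], so that
    [A - 1/2 >= A / 2]. Hoeffding's inequality ([hits_concentration]) bounds
    each tail by [exp (- 2 A^2 / n) = exp (- 2 t)], respectively
    [exp (- 2 (A / 2)^2 / n) = exp (- t / 2)], and the union bound concludes.

    Hoeffding's inequality is obtained without expectations. By independence,
    the probability that the set of successes is exactly [J] is a product over
    all indices ([hits_eq_prob]). Weighting the [J] with
    [exp (l * (#|J| - m)) >= 1] turns the sum over [#|J| >= m] into a part of
    an expanded product, each factor of which is the moment generating
    function of a Bernoulli variable ([hoeffding_bernoulli]). *)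

(** * A lower bound for the normal density *)

Lemma ge0_of_derive_ge0 {R : realType} {f df : R -> R} :
  (forall x : R, is_derive x 1 f (df x)) -> f 0 = 0 ->
  (forall x, 0 <= x -> 0 <= df x) -> forall x, 0 <= x -> 0 <= f x.
Proof.
move=> fdf f0 df0 x x0; rewrite -f0.
apply: (@ger0_derive1_ndecry _ f 0) => // [y|].
- rewrite in_itv/= andbT => y0; rewrite derive1E derive_val.
  exact/df0/ltW.
- apply: derivable_within_continuous => y _; exact: ex_derive.
Qed.

(** Taylor's bound for [sin], reached by integrating [cos <= 1] three times. *)
Lemma sin_ge_cubic (R : realType) (x : R) : 0 <= x -> x - x ^+ 3 / 6 <= sin x.
Proof.
have sin_le (y : R) : 0 <= y -> 0 <= y - sin y.
  have d (z : R) : is_derive z 1 (fun y => y - sin y) (1 - cos z).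
    exact: is_deriveB.
  apply: (ge0_of_derive_ge0 d); first by rewrite sin0 subr0.
  by move=> z _; rewrite subr_ge0 cos_le1.
have cos_ge (y : R) : 0 <= y -> 0 <= cos y - (1 - y ^+ 2 / 2).
  have d (z : R) : is_derive z 1 (fun y => cos y - (1 - y ^+ 2 / 2)) (z - sin z).
    by apply: is_derive_eq; rewrite /GRing.scale/=; field.
  by apply: (ge0_of_derive_ge0 d) => //; rewrite cos0; ring.
have d (z : R) : is_derive z 1 (fun y => sin y - (y - y ^+ 3 / 6))
    (cos z - (1 - z ^+ 2 / 2)).
  by apply: is_derive_eq; rewrite /GRing.scale/=; field.
move=> x0; rewrite -subr_ge0; move: x x0.
by apply: (ge0_of_derive_ge0 d) => //; rewrite sin0; ring.
Qed.

(** If [pi / 4] were larger than [0.79], then [sin (pi / 4)] would be at least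
    [0.79 - 0.79^3 / 6], whose square exceeds [1/2]. *)
Lemma pi_le_316 (R : realType) : (pi : R) <= 316%:R / 100%:R.
Proof.
have sin4 : sin (pi / 4 : R) ^+ 2 = 2^-1.
  have := cosD (pi / 4 : R) (pi / 4).
  rewrite (_ : pi / 4 + pi / 4 = pi / 2 :> R); last by field.
  rewrite cos_pihalf -!expr2 cos2sin2 => h; lra.
have p0 := pi_ge2 R.
rewrite leNgt; apply/negP => h.
have h1 : sin (79%:R / 100%:R) <= sin (pi / 4) :> R.
  by rewrite le_eqVlt ltr_sin ?in_itv/=; [|lra|lra]; apply/orP; right; lra.
have h2 := @sin_ge_cubic R (79%:R / 100%:R) ltac:(lra).
have h3 := le_trans h2 h1.
have : (79%:R / 100%:R - (79%:R / 100%:R) ^+ 3 / 6) ^+ 2 <= sin (pi / 4 : R) ^+ 2.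
  by rewrite lerXn2r ?nnegrE//; lra.
rewrite sin4; lra.
Qed.

(** This is where the constant [0.35] comes from: it is just below the value
    [0.3521] of the standard normal density at [1/2]. The margin is
    what makes the crude estimates [pi <= 3.16] and
    [(1 - 1/32)^4 <= exp (- 1/8)] sufficient. *)
Lemma std_normal_pdf_half_ge (R : realType) :
  35%:R / 100%:R <= (Num.sqrt (pi *+ 2))^-1 * expR (- 8^-1) :> R.
Proof.
have pg := pi_ge2 R; have pl := pi_le_316 R.
have e1 : (31%:R / 32%:R) ^+ 4 <= expR (- 8^-1) :> R.
  rewrite (_ : - 8^-1 = 4%:R * (- 32%:R^-1)); last by field.
  rewrite expRM_natl lerXn2r ?nnegrE ?expR_ge0//.
  by apply: le_trans (expR_ge1Dx _); lra.
have s0 : 0 < Num.sqrt (pi *+ 2) :> R by rewrite sqrtr_gt0; lra.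
rewrite ler_pdivlMl//; apply: le_trans e1.
rewrite -ler_pdivlMr; last lra.
rewrite -(ler_pXn2r (n := 2)) ?nnegrE ?sqrtr_ge0//.
by rewrite sqr_sqrtr; lra.
Qed.

(** * Hoeffding's inequality for independent events *)

(** With [D l] the moment generating function, [l p + l^2 / 8 - ln (D l)]
    vanishes at 0 together with its derivative, and its second derivative is
    [1/4 - q (1 - q) >= 0] for the tilted parameter
    [q = p exp l / D l]. *)
Lemma hoeffding_bernoulli (R : realType) (p l : R) : 0 <= p <= 1 -> 0 <= l ->
  1 - p + p * expR l <= expR (l * p + l ^+ 2 / 8).
Proof.
move=> /andP[p0 p1].
pose D (x : R) := 1 - p + p * expR x.
have D0 x : 0 < D x.
  rewrite /D; have := expR_gt0 x => e0.
  have [->|pn] := eqVneq p 0; first lra.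
  by have : 0 < p * expR x; [rewrite mulr_gt0// lt0r pn|lra].
have dD (x : R) : is_derive x 1 D (p * expR x).
  apply: is_derive_eq; rewrite /GRing.scale/=; ring.
(* The slope is [p + x / 4 - q], where [q = 1 - (1 - p) / D x]. *)
have slope_ge0 (x : R) : 0 <= x -> 0 <= p - 1 + x / 4 + (1 - p) * (D x)^-1.
  have d (z : R) : is_derive z 1 (fun x => p - 1 + x / 4 + (1 - p) * (D x)^-1)
      (4^-1 - (1 - p) * (p * expR z) / D z ^+ 2).
    have Dz := lt0r_neq0 (D0 z).
    have dV := is_deriveV Dz (dD z).
    by apply: is_derive_eq; rewrite /GRing.scale/=; field.
  apply: (ge0_of_derive_ge0 d) => [|z _].
  - by rewrite /D expR0 (_ : 1 - p + p * 1 = 1); [field|ring].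
  (* [4 q (1 - q) <= 1], as [4 u v <= (u + v)^2]. *)
  - rewrite subr_ge0 ler_pdivrMr ?exprn_gt0// /D.
    have := sqr_ge0 (1 - p - p * expR z). nra.
move=> l0.
rewrite -[leLHS]lnK ?posrE ?D0// ler_expR -subr_ge0; move: l l0.
have d (z : R) : is_derive z 1 (fun l => l * p + l ^+ 2 / 8 - ln (D l))
    (p - 1 + z / 4 + (1 - p) * (D z)^-1).
  have Dz := lt0r_neq0 (D0 z).
  have dl := @is_derive1_comp _ _ _ _ _ _ (is_derive1_ln (D0 z)) (dD z).
  apply: is_derive_eq; rewrite /GRing.scale/= /D; field.
  exact: Dz.
apply: (ge0_of_derive_ge0 d) => //.
by rewrite /D expR0 (_ : _ + _ * 1 = 1) ?ln1; ring.
Qed.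
Section hits.
Context {d d' : measure_display} {T : measurableType d} {T' : measurableType d'}
  {R : realType} {P : probability T R} {I : finType}.
Context (X : I -> {RV P >-> T'}) (B : I -> set T')
  (mB : forall i, measurable (B i)).

Definition hits (w : T) : {set I} := [set i | X i w \in B i]%SET.

Definition hit_prob (i : I) : R := fine (P (X i @^-1` B i)).

Lemma measurable_hit i : measurable (X i @^-1` B i).
Proof. by rewrite -[_ @^-1` _]setTI; exact: measurable_funP. Qed.

Lemma hit_probE i : P (X i @^-1` B i) = (hit_prob i)%:E.
Proof. by rewrite fineK// fin_num_measure//; exact: measurable_hit. Qed.

Lemma hit_prob01 i : 0 <= hit_prob i <= 1.
Proof.
rewrite -!lee_fin -hit_probE measure_ge0 probability_le1//.
exact: measurable_hit.
Qed.

Let C (J : {set I}) i := if i \in J then B i else ~` B i.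

Let mC J i : measurable (C J i).
Proof. by rewrite /C; case: ifP => _ //; exact: measurableC. Qed.

Let hits_eqE J : [set w | hits w = J] =
  \bigcap_(i in [set i | i \in [set: I]%SET]) (X i @^-1` C J i).
Proof.
apply/seteqP; split => [w <- i _ /=|w wC].
  rewrite /C !inE; case: ifPn; first by rewrite inE.
  by move=> /negP; rewrite inE.
apply/setP => i; have /= := wC i; rewrite /C !inE => /(_ isT).
by case: (i \in J) => h; [exact/mem_set|by apply/negbTE/negP => /set_mem].
Qed.

Lemma measurable_hits_eq J : measurable [set w | hits w = J].
Proof.
rewrite hits_eqE; apply: fin_bigcap_measurable => [|i _].
  exact: finite_finset.
by rewrite -[_ @^-1` _]setTI; exact: measurable_funP.
Qed.

Lemma measurable_hits (Q : pred {set I}) : measurable [set w | Q (hits w)].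
Proof.
rewrite (_ : mkset _ = \bigcup_(J in [set J | Q J]) [set w | hits w = J]).
  apply: fin_bigcup_measurable => [|J _]; last exact: measurable_hits_eq.
  exact: finite_finset.
by apply/seteqP; split => [w Qw|w [J QJ /= ->]]//; exists (hits w).
Qed.

Context (hind : independent_RVs X).

(** Prescribing the whole set of successes constrains every [X i], to [B i] or
    to its complement, so independence applies to the full family. *)
Lemma hits_eq_prob J : P [set w | hits w = J] =
  (\prod_i if i \in J then hit_prob i else 1 - hit_prob i)%:E.
Proof.
rewrite hits_eqE hind; last by move=> i _; exact: mC.
rewrite -prodEFin; apply: eq_big => [i|i _]; first by rewrite inE.
rewrite /C; case: ifP => _; first exact: hit_probE.
rewrite -[X in P X]/(~` (X i @^-1` B i)).
rewrite probability_setC; last exact: measurable_hit.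
by rewrite hit_probE.
Qed.

Lemma hits_prob (Q : pred {set I}) : P [set w | Q (hits w)] =
  (\sum_(J in {set I} | Q J)
     \prod_i if i \in J then hit_prob i else 1 - hit_prob i)%:E.
Proof.
rewrite (_ : mkset _ =
    \bigcup_(J in [set J | Q J]) [set w | hits w = J]); last first.
  by apply/seteqP; split => [w Qw|w [J QJ /= ->]]//; exists (hits w).
rewrite measure_fin_bigcup//=; last 2 first.
- by move=> J K _ _ [w [/= <- <-]].
- by move=> J _; exact: measurable_hits_eq.
rewrite -sumEFin (bigfs _ (index_enum_uniq _)); last first.
  by move=> J _; rewrite mem_index_enum.
by apply: eq_fsbigr => J _; exact: hits_eq_prob.
Qed.

(** Chernoff's bound, with the exponential weight put on the finitely many
    values of [hits] instead of on the sample space. *)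
Lemma hits_tail (l : R) (m : nat) : 0 <= l ->
  (P [set w | (m <= #|hits w|)%N] <=
   (expR (l * (\sum_i hit_prob i - m%:R) + #|I|%:R * l ^+ 2 / 8))%:E)%E.
Proof.
move=> l0; rewrite (hits_prob (fun J => m <= #|J|)%N) lee_fin.
apply: (@le_trans _ _ (expR (- (l * m%:R)) *
    \prod_i (hit_prob i * expR l + (1 - hit_prob i)))).
  (* Expanding the product gives one term for each [J : {set I}]. *)
  rewrite bigA_distr mulr_sumr big_mkcondr ler_sum// => J _.
  have pr (K : {set I}) :
      0 <= \prod_i (if i \in K then hit_prob i else 1 - hit_prob i).
    apply: prodr_ge0 => i _; have /andP[? ?] := hit_prob01 i.
    by case: ifP; rewrite ?subr_ge0.
  have -> : \prod_i (if i \in J then hit_prob i * expR l else 1 - hit_prob i) =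
      expR (l * #|J|%:R) *
      \prod_i (if i \in J then hit_prob i else 1 - hit_prob i).
    rewrite mulrC expRM_natr -prodr_const [X in _ * X]big_mkcond -big_split/=.
    by apply: eq_bigr => i _; case: ifP; rewrite ?mulr1.
  rewrite mulrA -expRD; case: ifP => [mJ|_]; last by rewrite mulr_ge0 ?expR_ge0.
  by rewrite ler_peMl// (le_trans _ (expR_ge1Dx _))// lerDl addrC subr_ge0
    ler_wpM2l// ler_nat.
apply: (@le_trans _ _ (expR (- (l * m%:R)) *
    \prod_i expR (l * hit_prob i + l ^+ 2 / 8))).
  rewrite ler_wpM2l ?expR_ge0//; apply: ler_prod => i _; have hp := hit_prob01 i.
  apply/andP; split; last by rewrite addrC hoeffding_bernoulli.
  by rewrite addr_ge0 ?mulr_ge0 ?expR_ge0//; lra.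
rewrite -expR_sum -expRD ler_expR big_split/= sumr_const -mulr_sumr -mulr_natl.
by rewrite le_eqVlt; apply/orP; left; apply/eqP; ring.
Qed.

Lemma hits_concentration (m : nat) : (0 < #|I|)%N -> \sum_i hit_prob i <= m%:R ->
  (P [set w | (m <= #|hits w|)%N] <=
   (expR (- (2 * (m%:R - \sum_i hit_prob i) ^+ 2 / #|I|%:R)))%:E)%E.
Proof.
move=> I0 le_m; set S := \sum_i hit_prob i.
have N0 : 0 < #|I|%:R :> R by rewrite ltr0n.
(* The minimizer of the quadratic exponent in [hits_tail]. *)
have l0 : 0 <= 4 * (m%:R - S) / #|I|%:R.
  by rewrite divr_ge0// mulr_ge0 ?subr_ge0.
apply: le_trans (hits_tail _ m l0) _; rewrite -/S lee_fin ler_expR le_eqVlt.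
by apply/orP; left; apply/eqP; field; rewrite gt_eqF.
Qed.

End hits.

(** * Tails of the centred normal law *)

Section normal_tail.
Import numFieldTopology.Exports.

Lemma normal_prob_sym {R : realType} (sigma s : R) : 0 < sigma ->
  normal_prob 0 sigma `]-oo, - s[ = normal_prob 0 sigma `]s, +oo[.
Proof.
move=> sg0; rewrite /normal_prob.
have mf : measurable_fun [set: R] (normal_pdf 0 sigma).
  exact: measurable_normal_pdf.
(* The change of variables needs closed endpoints. *)
rewrite integral_itv_bndo_bndc; last exact/measurable_EFinP/measurable_funTS.
rewrite [RHS]integral_itv_obnd_cbnd; last exact/measurable_EFinP/measurable_funTS.
rewrite ge0_integration_by_substitutionNy; last 2 first.
- apply: continuous_subspaceT; exact/continuous_normal_pdf/lt0r_neq0.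
- by move=> x _; exact: normal_pdf_ge0.
apply: eq_integral => x _; congr EFin.
by rewrite /= !normal_pdfE ?gt_eqF// /normal_fun !subr0 sqrrN.
Qed.

Lemma normal_prob_center_ge {R : realType} (sigma s : R) : 0 < sigma ->
  0 <= s <= 2^-1 * sigma ->
  ((2 * (35%:R / 100%:R * (s / sigma)))%:E <= normal_prob 0 sigma `[(- s)%R, s])%E.
Proof.
move=> sg0 /andP[s0 s1]; rewrite /normal_prob.
have mf : measurable_fun [set: R] (normal_pdf 0 sigma).
  exact: measurable_normal_pdf.
apply: (@le_trans _ _ (\int[lebesgue_measure]_(x in `[(- s)%R, s])
    (35%:R / 100%:R / sigma)%:E)%E).
  rewrite integral_cst//= lebesgue_measure_itv/= lte_fin.
  case: ifPn => h.
    rewrite -EFinD -EFinM lee_fin le_eqVlt; apply/orP; left; apply/eqP.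
    by field; rewrite gt_eqF.
  rewrite mule0 lee_fin; have -> : s = 0 by lra.
  by rewrite mul0r !mulr0.
apply: ge0_le_integral => //.
- by move=> x _; rewrite lee_fin divr_ge0// ltW.
- exact/measurable_EFinP/measurable_funTS.
move=> x; rewrite /= in_itv/= => xs; rewrite lee_fin normal_pdfE ?gt_eqF//.
have -> : normal_peak sigma = (Num.sqrt (pi *+ 2))^-1 / sigma.
  rewrite /normal_peak -mulrnAr sqrtrM ?sqr_ge0// sqrtr_sqr gtr0_norm//.
  by rewrite invfM mulrC.
rewrite [leRHS]mulrAC ler_pM2r ?invr_gt0//.
apply: le_trans (std_normal_pdf_half_ge R) _.
rewrite ler_wpM2l ?invr_ge0 ?sqrtr_ge0// ler_expR subr0 mulNr lerN2.
rewrite ler_pdivrMr; last by rewrite mulrn_wgt0// exprn_gt0.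
nra.
Qed.

(** The two tails have the same mass and share what the central interval
    leaves. *)
Lemma normal_tail_le {R : realType} (sigma s : R) : 0 < sigma ->
  0 <= s <= 2^-1 * sigma ->
  (normal_prob 0 sigma `]s, +oo[ <= (2^-1 - 35%:R / 100%:R * (s / sigma))%:E)%E.
Proof.
move=> sg0 hs; have /andP[s0 _] := hs.
have c := normal_prob_center_ge sigma s sg0 hs.
have : (normal_prob 0 sigma [set: R] = 1)%E.
  exact: (@probability_setT _ _ _ (normal_prob 0 sigma)).
have -> : [set: R] = `]-oo, - s[ `|` (`[- s, s] `|` `]s, +oo[).
  apply/seteqP; split => x // _; rewrite /= !in_itv/= andbT.
  by have [] := ltP x (- s); have [] := leP x s; auto.
rewrite measureU//=; last 2 first.
- exact: measurableU.
- apply/seteqP; split => x //=; rewrite !in_itv/= andbT; lra.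
rewrite measureU//=; last first.
  apply/seteqP; split => x //=; rewrite !in_itv/= andbT; lra.
rewrite normal_prob_sym//.
have /fineK <- : normal_prob 0 sigma `]s, +oo[ \is a fin_num.
  exact: fin_num_measure.
move: c.
have /fineK <- : normal_prob 0 sigma `[- s, s] \is a fin_num.
  exact: fin_num_measure.
rewrite -!EFinD !lee_fin => c [] h; lra.
Qed.

End normal_tail.

(** * Order statistics as counts *)

(** In a decreasing list, the entries that satisfy an upward closed predicate
    come first, so the [j]-th entry (counted from 1) is among them exactly when
    there are at least [j] of them. *)
Lemma sorted_nth_count {d : Order.disp_t} {T : orderType d} (x0 : T) (s : seq T)
    (a : pred T) (j : nat) :
  (forall u v, (u <= v)%O -> a u -> a v) -> sorted >=%O s ->
  (0 < j <= size s)%N -> a (nth x0 s j.-1) = (j <= count a s)%N.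
Proof.
move=> aup; elim: s j => [|y s IH] [|j]//= ys js.
have := ys; rewrite path_sortedE; last first.
  by move=> u v w uv vw; exact: le_trans vw uv.
move=> /andP[/allP ally ss]; have [ay|ay] := boolP (a y).
  by case: j js => [//|j] js /=; rewrite add1n ltnS -IH.
have nas z : z \in s -> ~~ a z.
  by move=> zs; apply: contra ay; exact/aup/ally.
rewrite (_ : count a s = 0%N); last first.
  by apply/eqP; rewrite -leqn0 leqNgt -has_count; apply/hasPn.
(* [nth] is taken at [j.-1]: the head for [j = 1], the tail beyond. *)
case: j js => [_ /=|j /= js]; first exact: negbTE.
by apply/negbTE/nas/mem_nth.
Qed.

Lemma order_stat_count {R : realType} {n : nat} (x : 'I_n -> R) (a : pred R)
    (j : nat) : (forall u v, u <= v -> a u -> a v) -> (0 < j <= n)%N ->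
  a (order_stat x j) = (j <= #|[set k | a (x k)]%SET|)%N.
Proof.
move=> aup jn; rewrite /order_stat sorted_nth_count//.
- by rewrite count_sort count_map cardsE cardE -size_filter enumT.
- by apply: sort_sorted => u v; exact: le_total.
- by rewrite size_sort size_map size_enum_ord.
Qed.

Lemma median_gt {R : realType} {n : nat} (x : 'I_n -> R) (s : R) : (2 <= n)%N ->
  (s < median x) = (n./2 <= #|[set k | (s < x k)%R]%SET|)%N.
Proof.
move=> n2; rewrite medianE (order_stat_count x (fun v => s < v))//.
- by move=> u v uv su; exact: lt_le_trans su uv.
- lia.
Qed.

(** By complement: fewer than [n./2] entries are at least [s], so more than
    [n - n./2] are below [s]. *)
Lemma median_lt {R : realType} {n : nat} (x : 'I_n -> R) (s : R) : (2 <= n)%N ->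
  (median x < s) = ((n - n./2).+1 <= #|[set k | (x k < s)%R]%SET|)%N.
Proof.
move=> n2; rewrite ltNge medianE (order_stat_count x (fun v => s <= v)); last 2 first.
- by move=> u v uv su; exact: le_trans su uv.
- lia.
have -> : [set k | s <= x k]%SET = (~: [set k | (x k < s)%R])%SET.
  by apply/setP => k; rewrite !inE leNgt.
have := cardsC [set k | (x k < s)%R]%SET; rewrite card_ord.
lia.
Qed.

(** * The median of independent centred normal variables *)

Theorem corollary6 (R : realType) (d : measure_display) (T : measurableType d)
    (P : probability T R) (n : nat) (hn : (2 <= n)%N)
    (sigma : 'I_n -> R) (hsigma : forall k, 0 < sigma k)
    (X : 'I_n -> {RV P >-> R})
    (hX : forall k, has_law (X k) (normal_prob 0 (sigma k)))
    (hind : independent_RVs X)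
    (t : R) (ht : 0 < t)
    (hbound : median_bound sigma t <=
       2^-1 * \big[Num.min/sigma (Ordinal (ltnW hn))]_(k < n) sigma k) :
  (~~ odd n ->
     ((1 - 2 * expR (- (2 * t)))%R%:E <=
      P [set w | (`|median (fun k => X k w)| <= median_bound sigma t)%R])%E)
  /\
  (odd n -> 4 <= t * n%:R ->
     ((1 - 2 * expR (- (t / 2)))%R%:E <=
      P [set w | (`|median (fun k => X k w)| <= median_bound sigma t)%R])%E).
Proof.
set s := median_bound sigma t in hbound *.
pose A := Num.sqrt n%:R * Num.sqrt t : R.
have n0 : 0 < n%:R :> R by rewrite ltr0n ltnW.
have A2 : A ^+ 2 = n%:R * t by rewrite exprMn !sqr_sqrtr ?ltW.
have A0 : 0 <= A by rewrite mulr_ge0 ?sqrtr_ge0.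
have S0 : 0 < \sum_(k < n) (sigma k)^-1.
  rewrite (bigD1 (Ordinal (ltnW hn)))//= ltr_wpDr ?invr_gt0// sumr_ge0// => k _.
  by rewrite invr_ge0 ltW.
have sA : \sum_(k < n) (35%:R / 100%:R * (s / sigma k)) = A.
  rewrite -mulr_sumr -mulr_sumr /s /median_bound -/A; field.
  by rewrite gt_eqF.
have hs k : 0 <= s <= 2^-1 * sigma k.
  apply/andP; split.
    by rewrite /s /median_bound -/A divr_ge0// mulr_ge0 ?ltW.
  by apply: le_trans hbound _; rewrite ler_pM2l// bigmin_le.
pose up (k : 'I_n) : set R := [set` `]s, +oo[%R].
pose low (k : 'I_n) : set R := [set` `]-oo, - s[%R].
have mup k : measurable (up k) by exact: measurable_itv.
have mlow k : measurable (low k) by exact: measurable_itv.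
(* [c] is the fraction of the excess [A] that survives rounding [n / 2]:
   1 for even [n], 1/2 for odd [n]. *)
have tail (B : 'I_n -> set R) (m : nat) (c : R) : (forall k, measurable (B k)) ->
    (forall k, (normal_prob 0 (sigma k) (B k) <=
      (2^-1 - 35%:R / 100%:R * (s / sigma k))%:E)%E) ->
    0 <= c -> c * A <= m%:R - n%:R / 2 + A ->
    (P [set w | (m <= #|hits X B w|)%N] <= (expR (- (2 * c ^+ 2 * t)))%:E)%E.
  move=> mB pB c0 cA.
  have pS : \sum_k hit_prob X B k <= n%:R / 2 - A.
    have -> : n%:R / 2 - A =
        \sum_(k < n) (2^-1 - 35%:R / 100%:R * (s / sigma k)).
      by rewrite sumrB sA sumr_const card_ord -[2^-1 *+ n]mulr_natl.
    apply: ler_sum => k _; rewrite -lee_fin -hit_probE//.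
    by apply: le_trans (pB k); rewrite -(hX k _ (mB k)).
  have cA0 : 0 <= c * A by rewrite mulr_ge0.
  apply: le_trans (hits_concentration X B mB hind m _ _) _.
  - by rewrite card_ord ltnW.
  - lra.
  rewrite card_ord lee_fin ler_expR lerN2 ler_pdivlMr//.
  have -> : 2 * c ^+ 2 * t * n%:R = 2 * (c * A) ^+ 2 by rewrite exprMn A2; ring.
  by rewrite ler_pM2l// lerXn2r ?nnegrE//; lra.
have main (c : R) : 0 <= c -> c * A <= (n./2)%:R - n%:R / 2 + A ->
    c * A <= (n - n./2).+1%:R - n%:R / 2 + A ->
    ((1 - 2 * expR (- (2 * c ^+ 2 * t)))%R%:E <=
      P [set w | (`|median (fun k => X k w)| <= s)%R])%E.
  move=> c0 c1 c2.
  have t1 := tail up _ c mup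
    (fun k => normal_tail_le _ _ (hsigma k) (hs k)) c0 c1.
  have lowle k : (normal_prob 0 (sigma k) (low k) <=
      (2^-1 - 35%:R / 100%:R * (s / sigma k))%:E)%E.
    by rewrite /low normal_prob_sym//; exact: normal_tail_le.
  have t2 := tail low _ c mlow lowle c0 c2.
  set U := [set w | _] in t1; set V := [set w | _] in t2.
  have mU : measurable U.
    exact: (measurable_hits X up mup (fun J => _ <= #|J|)%N).
  have mV : measurable V.
    exact: (measurable_hits X low mlow (fun J => _ <= #|J|)%N).
  have -> : [set w | `|median (fun k => X k w)| <= s] = ~` (U `|` V).
    have hup w : hits X up w = [set k | s < X k w]%SET.
      apply/setP => k; rewrite !inE /up.
      by apply/idP/idP => [/set_mem|h]; [|apply/mem_set];
        rewrite /= in_itv/= andbT.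
    have hlow w : hits X low w = [set k | (X k w < - s)%R]%SET.
      apply/setP => k; rewrite !inE /low.
      by apply/idP/idP => [/set_mem|h]; [|apply/mem_set]; rewrite /= in_itv/=.
    have -> : U = [set w | s < median (fun k => X k w)].
      by apply/funext => w; rewrite /U /mkset hup -median_gt.
    have -> : V = [set w | median (fun k => X k w) < - s].
      by apply/funext => w; rewrite /V /mkset hlow -median_lt.
    apply/seteqP; split => w /=; rewrite ler_norml.
      by move=> /andP[? ?] []; rewrite ltNge => /negP.
    move=> h; rewrite !leNgt.
    by apply/andP; split; apply/negP => h'; apply: h; auto.
  rewrite probability_setC; last exact: measurableU.
  rewrite EFinB; apply: leeB => //; apply: le_trans (measureU2 P mU mV) _.
  by rewrite mulrC mulr2n mulrDr mulr1 EFinD; exact: leeD.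
have upper_half : n%:R / 2 <= (n - n./2).+1%:R :> R.
  by rewrite ler_pdivrMr// -natrM ler_nat; lia.
split=> [ne|no tn].
  have half_n : (n./2)%:R = n%:R / 2 :> R.
    by rewrite -[n in RHS]odd_double_half (negbTE ne) add0n -muln2 natrM mulfK.
  have := main 1 ler01; rewrite expr1n mulr1; apply; first lra.
  lra.
have half_n : (n./2)%:R = n%:R / 2 - 2^-1 :> R.
  by rewrite -[n in RHS]odd_double_half no natrD -muln2 natrM /=; field.
have A_ge2 : 2 <= A.
  by rewrite -(ler_pXn2r (n := 2)) ?nnegrE// A2; lra.
have -> : t / 2 = 2 * (2^-1) ^+ 2 * t by field.
apply: main; [by [] | lra | ].
lra.
Qed.
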